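(* Let $a>0$ and let $\epsilon>0$ be sufficiently small. Consider the regularized system $$\dot x=1,\qquad \epsilon\dot v=-a\epsilon v-\sin\!\left(\pi x\left[1+\tfrac12\psi(v)\right]\right).$$ Then every trajectory $v(x)$ of this system tends, as $x\to+\infty$, to the $4$-periodic function $v_r$ defined below, i.e. $v(x)-v_r(x)\to0$ as $x\to+\infty$.
   Context: $\psi:\mathbb{R}\to\mathbb{R}$ is a transition function: $C^1$ on $\mathbb{R}$ and $C^2$ on $[-1,1]$, with $\psi(v)=\operatorname{sign}(v)$ for $|v|\ge1$, $\psi'(v)>0$ for $|v|<1$, and $\operatorname{sign}\psi''(v)=-\operatorname{sign}(v)$ at $|v|=1$. For $n\in\mathbb{N}$ let $x^-_{\epsilon,2n}=4n+\frac{2}{\pi}\arcsin(a\epsilon)$ (the fold point near $x=4n$ on $v=-1$, where $a\epsilon-\sin(\pi x/2)=0$). Let $v_-(x,x_0)$ be the solution of $\epsilon\dot v=-a\epsilon v-\sin(\pi x/2)$ with $v_-(x_0,x_0)=-1$, and let $x_{\epsilon,a}>0$ be such that $x^-_{\epsilon,2n}+x_{\epsilon,a}$ is the next $x>x^-_{\epsilon,2n}$ at which $v_-(x,x^-_{\epsilon,2n})=-1$ (independent of $n$ by periodicity). The function $v_r$ is defined by $v_r(x)=v_-(x,x^-_{\epsilon,2n})$ for $x\in[x^-_{\epsilon,2n},x^-_{\epsilon,2n}+x_{\epsilon,a}]$ and $v_r(x)=-1$ for $x\in(x^-_{\epsilon,2n}+x_{\epsilon,a},x^-_{\epsilon,2n+2})$,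 $n\in\mathbb{N}$. *)

(* Defs.v *)
From Stdlib Require Import Reals Lra.
From Coquelicot Require Import Coquelicot.
Open Scope R_scope.

Definition I11 (v : R) : Prop := -1 <= v <= 1.

Definition transition_function (psi : R -> R) : Prop :=
  exists dpsi d2psi : R -> R,
    (forall v, is_derive psi v (dpsi v)) /\
    (forall v, continuous dpsi v) /\
    (* C^2 on [-1,1]: dpsi is differentiable relative to [-1,1]
       with derivative d2psi, continuous on [-1,1] *)
    (forall v, I11 v ->
       filterlim (fun y => (dpsi y - dpsi v) / (y - v))
                 (within (fun y => I11 y /\ y <> v) (locally v))
                 (locally (d2psi v))) /\
    (forall v, I11 v ->
       filterlim d2psi (within I11 (locally v)) (locally (d2psi v))) /\
    (forall v, 1 <= v -> psi v = 1) /\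
    (forall v, v <= -1 -> psi v = -1) /\
    (forall v, -1 < v < 1 -> 0 < dpsi v) /\
    d2psi 1 < 0 /\ 0 < d2psi (-1).

Definition rhs (psi : R -> R) (a eps x v : R) : R :=
  (- a * eps * v - sin (PI * x * (1 + psi v / 2))) / eps.

(* A trajectory v(x) of the regularized system (x' = 1, so x is the time),
   defined for x > x0. *)
Definition trajectory (psi : R -> R) (a eps x0 : R) (v : R -> R) : Prop :=
  forall x, x0 < x -> is_derive v x (rhs psi a eps x (v x)).

Definition xfold (a eps : R) (n : Z) : R :=
  4 * IZR n + 2 / PI * asin (a * eps).

(* v_-(x, x0): the solution of eps v' = - a eps v - sin(pi x / 2)
   with v(x0) = -1 (variation of constants formula). *)
Definition vminus (a eps x x0 : R) : R :=
  - exp (- a * (x - x0))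
  - / eps * RInt (fun s => exp (- a * (x - s)) * sin (PI * s / 2)) x0 x.

Definition first_return (a eps xa : R) : Prop :=
  0 < xa /\
  vminus a eps (xfold a eps 0 + xa) (xfold a eps 0) = -1 /\
  (forall y, 0 < y < xa ->
     vminus a eps (xfold a eps 0 + y) (xfold a eps 0) <> -1).

(* The function v_r: on [x^-_{2n}, x^-_{2n} + xa] it is v_-(x, x^-_{2n}),
   on (x^-_{2n} + xa, x^-_{2n+2}) it is -1.  The index n is determined by
   x^-_{2n} <= x < x^-_{2n+2}. *)
Definition v_r (a eps xa x : R) : R :=
  let n := Int_part ((x - xfold a eps 0) / 4) in
  let base := xfold a eps n in
  if Rle_dec (x - base) xa then vminus a eps x base else -1.

(* Main.v *)
Require Import Defs.
From Stdlib Require Import Reals Lra Lia ZArith Classical.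
From Coquelicot Require Import Coquelicot.
Open Scope R_scope.

(* Along a trajectory put u(x) = x (1 + psi(v(x)) / 2), so that
   v' = - a v - sin(pi u) / eps and x / 2 <= u <= 3 x / 2, with u = x / 2 exactly when
   v <= -1.  If v does not increase, u grows at a rate at most 3 / 2; since
   sin(pi u) >= 1/2 on the band 2m + 1/4 <= u <= 2m + 1/2, crossing that band would cost v
   more than 2 when eps is small.  Hence u stays below 2m + 1/2 until x reaches the fold
   x^-_{2m} ~ 4m; there u - x / 2 <= 1/2, so psi(v) + 1 = O(1/x) and v is close to -1.
   Just after the fold v is pushed below -1, follows the linear equation of v_-, returns to
   -1 near the same time as v_-, and is then held by the next band until x^-_{2m+2}.
   It remains to see that every trajectory is caught by some band.  Otherwise
   liminf v >= 1; as v decreases while 3 x / 2 is in [2m + 1/4, 2m + 1], v is >= 1 there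
   except very close to the right end, and over each period the damping makes v lose a
   fixed amount, which is absurd. *)

(** * Calculus *)

Lemma mean_value (f df : R -> R) (p q : R) :
  p <= q -> (forall x, p <= x <= q -> is_derive f x (df x)) ->
  exists c, p <= c <= q /\ f q - f p = df c * (q - p).
Proof.
  intros Hpq Hd.
  destruct (MVT_gen f p q df) as [c [Hc E]];
    rewrite ?Rmin_left, ?Rmax_right in * by assumption.
  - intros x Hx. apply Hd. lra.
  - intros x Hx. apply derivable_continuous_pt. exists (df x).
    apply is_derive_Reals. apply Hd. exact Hx.
  - exists c. auto.
Qed.

Lemma increment_le (f df : R -> R) (k p q : R) :
  p <= q -> (forall x, p <= x <= q -> is_derive f x (df x)) ->
  (forall x, p <= x <= q -> df x <= k) ->
  f q - f p <= k * (q - p).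
Proof.
  intros Hpq Hd Hk.
  destruct (mean_value f df p q Hpq Hd) as [c [Hc ->]].
  apply Rmult_le_compat_r. lra. apply Hk. exact Hc.
Qed.

Lemma increment_ge (f df : R -> R) (k p q : R) :
  p <= q -> (forall x, p <= x <= q -> is_derive f x (df x)) ->
  (forall x, p <= x <= q -> k <= df x) ->
  k * (q - p) <= f q - f p.
Proof.
  intros Hpq Hd Hk.
  destruct (mean_value f df p q Hpq Hd) as [c [Hc ->]].
  apply Rmult_le_compat_r. lra. apply Hk. exact Hc.
Qed.

(** The hitting point is the supremum [r] of the points up to which [f] stays below [c]. If
    [f r > c], the same would hold just left of [r]; if [f r < c], the set would reach past [r]. *)
Lemma first_hit_strict (f : R -> R) (p q c : R) :
  p <= q -> (forall x, p <= x <= q -> continuous f x) ->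
  f p <= c -> c <= f q ->
  exists r, p <= r <= q /\ f r = c /\ forall x, p <= x < r -> f x < c.
Proof.
  intros Hpq Hc Hp Hq.
  set (E := fun x => p <= x <= q /\ forall y, p <= y < x -> f y < c).
  assert (Ep : E p) by (split; [lra|intros; lra]).
  destruct (completeness E) as [r [Hub Hlub]].
  { exists q. intros x [Hx _]. lra. }
  { exists p. exact Ep. }
  assert (Hpr : p <= r) by exact (Hub p Ep).
  assert (Hrq : r <= q). { apply Hlub. intros x [Hx _]. lra. }
  assert (Hbelow : forall x, p <= x < r -> f x < c).
  { intros x Hx. apply Rnot_le_lt. intros H.
    apply (Rlt_irrefl r). apply Rle_lt_trans with x; [|lra].
    apply Hlub. intros z [Hz Hzc]. apply Rnot_lt_le. intros Hxz.
    specialize (Hzc x ltac:(lra)). lra. }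
  exists r. split; [lra|]. split; [|exact Hbelow].
  apply Rle_antisym; apply Rnot_lt_le; intros H.
  - assert (Hlt : p < r). { destruct (Req_dec p r) as [E0|]; [rewrite <- E0 in H|]; lra. }
    destruct (Hc r (conj Hpr Hrq) _ (open_gt c (f r) H)) as [d Hd].
    assert (Hd0 := cond_pos d).
    set (x := Rmax p (r - d / 2)).
    assert (p <= x < r). { split. apply Rmax_l. apply Rmax_lub_lt; lra. }
    assert (r - d / 2 <= x) by apply Rmax_r.
    assert (c < f x).
    { apply Hd. unfold ball; simpl; unfold AbsRing_ball, abs, minus, plus, opp; simpl.
      apply Rabs_def1; lra. }
    specialize (Hbelow x ltac:(lra)). lra.
  - assert (Hlt : r < q). { destruct (Req_dec r q) as [E0|]; [rewrite E0 in H|]; lra. }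
    destruct (Hc r (conj Hpr Hrq) _ (open_lt c (f r) H)) as [d Hd].
    assert (Hd0 := cond_pos d).
    set (x := Rmin q (r + d / 2)).
    assert (r < x <= q). { split. apply Rmin_glb_lt; lra. apply Rmin_l. }
    assert (x <= r + d / 2) by apply Rmin_r.
    apply (Rlt_irrefl r). apply Rlt_le_trans with x; [lra|].
    apply Hub. split. lra. intros y Hy.
    destruct (Rlt_dec y r) as [Hyr|Hyr]; [apply Hbelow; lra|].
    apply Hd.
    unfold ball; simpl; unfold AbsRing_ball, abs, minus, plus, opp; simpl.
    apply Rabs_def1; lra.
Qed.

Lemma first_hit (f : R -> R) (p q c : R) :
  p <= q -> (forall x, p <= x <= q -> continuous f x) ->
  f p <= c -> c <= f q ->
  exists r, p <= r <= q /\ f r = c /\ forall x, p <= x <= r -> f x <= c.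
Proof.
  intros Hpq Hc Hp Hq.
  destruct (first_hit_strict f p q c Hpq Hc Hp Hq) as [r [Hr [E H]]].
  exists r. split; [exact Hr|]. split; [exact E|]. intros x Hx.
  destruct (Req_dec x r) as [->|]; [|apply Rlt_le, H]; lra.
Qed.

Lemma continuous_reflect (f : R -> R) (s x : R) :
  continuous f (s - x) -> continuous (fun y => - f (s - y)) x.
Proof.
  intros H. apply (continuous_opp (fun y => f (s - y))).
  apply (continuous_comp (fun y => s - y) f); [|exact H].
  apply (continuous_minus (fun _ : R => s) (fun y : R => y)).
  apply continuous_const. apply continuous_id.
Qed.

(** Reflecting the interval and changing the sign turns the last passage into a first one. *)
Lemma last_hit (f : R -> R) (p q c : R) :
  p <= q -> (forall x, p <= x <= q -> continuous f x) ->
  f p <= c -> c <= f q ->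
  exists r, p <= r <= q /\ f r = c /\ forall x, r <= x <= q -> c <= f x.
Proof.
  intros Hpq Hc Hp Hq.
  destruct (first_hit (fun y => - f (p + q - y)) p q (- c)) as [r [Hr [E H]]].
  - exact Hpq.
  - intros x Hx. apply continuous_reflect. apply Hc. lra.
  - replace (p + q - p) with q by ring. lra.
  - replace (p + q - q) with p by ring. lra.
  - exists (p + q - r). split; [lra|]. split; [lra|].
    intros x Hx. specialize (H (p + q - x) ltac:(lra)). cbv beta in H.
    replace (p + q - (p + q - x)) with x in H by ring. lra.
Qed.

Lemma last_hit_down (f : R -> R) (p q c : R) :
  p <= q -> (forall x, p <= x <= q -> continuous f x) ->
  c <= f p -> f q <= c ->
  exists r, p <= r <= q /\ f r = c /\ forall x, r <= x <= q -> f x <= c.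
Proof.
  intros Hpq Hc Hp Hq.
  destruct (last_hit (fun x => - f x) p q (- c)) as [r [Hr [E H]]]; try lra.
  - intros x Hx. apply (continuous_opp f). apply Hc. exact Hx.
  - exists r. split; [lra|]. split; [lra|]. intros x Hx. specialize (H x Hx). lra.
Qed.

(** * Periodicity and bounds of sine and cosine *)

Lemma sin_period_Z (x : R) (k : Z) : sin (x + 2 * IZR k * PI) = sin x.
Proof.
  destruct (Z_le_gt_dec 0 k) as [H|H].
  - rewrite <- (Z2Nat.id k) by lia. rewrite <- INR_IZR_INZ. apply sin_period.
  - rewrite <- (sin_period _ (Z.to_nat (- k))). f_equal.
    rewrite INR_IZR_INZ, Z2Nat.id, opp_IZR by lia. ring.
Qed.

Lemma cos_period_Z (x : R) (k : Z) : cos (x + 2 * IZR k * PI) = cos x.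
Proof.
  rewrite !cos_sin. replace (PI / 2 + (x + 2 * IZR k * PI)) with (PI / 2 + x + 2 * IZR k * PI) by ring.
  apply sin_period_Z.
Qed.

(** Once the period is removed, [sin (PI * r)] is symmetric about [r = 1/2] and increasing before
    it, so the minimum is at the ends. *)
Lemma sin_phase_ge (s t : R) (m : Z) :
  0 <= s <= / 2 -> 2 * IZR m + s <= t <= 2 * IZR m + 1 - s ->
  sin (PI * s) <= sin (PI * t).
Proof.
  intros Hs Ht. assert (HP := PI_RGT_0).
  replace (PI * t) with (PI * (t - 2 * IZR m) + 2 * IZR m * PI) by ring.
  rewrite sin_period_Z.
  set (r := t - 2 * IZR m). assert (Hr : s <= r <= 1 - s) by (unfold r; lra).
  destruct (Rle_dec r (/ 2)) as [H|H].
  - apply sin_incr_1; nra.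
  - rewrite <- (sin_PI_x (PI * r)). apply sin_incr_1; nra.
Qed.

Lemma sin_phase_le (s t : R) (m : Z) :
  0 <= s <= / 2 -> 2 * IZR m - 1 - s <= t <= 2 * IZR m + s ->
  sin (PI * t) <= sin (PI * s).
Proof.
  intros Hs Ht. assert (HP := PI_RGT_0).
  replace (PI * t) with (PI * (t - 2 * IZR m) + 2 * IZR m * PI) by ring.
  rewrite sin_period_Z.
  set (r := t - 2 * IZR m). assert (Hr : - 1 - s <= r <= s) by (unfold r; lra).
  destruct (Rle_dec (- / 2) r) as [H|H].
  - apply sin_incr_1; nra.
  - replace (sin (PI * r)) with (sin (PI * (- 1 - r))).
    + apply sin_incr_1; nra.
    + replace (PI * (-1 - r)) with (- (PI * r + PI)) by ring.
      rewrite sin_neg, neg_sin. ring.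
Qed.

Lemma half_le_sin (t : R) (m : Z) :
  2 * IZR m + / 4 <= t <= 2 * IZR m + 3 / 4 -> / 2 <= sin (PI * t).
Proof.
  intros Ht. assert (E : sin (PI * / 6) = / 2).
  { change (PI * / 6) with (PI / 6). rewrite sin_PI6. lra. }
  rewrite <- E. apply (sin_phase_ge _ _ m); lra.
Qed.

Lemma cos_ge_1_minus (t : R) : 0 <= t -> 1 - t <= cos t.
Proof.
  intros Ht. assert (H := increment_ge cos (fun x => - sin x) (-1) 0 t Ht).
  rewrite cos_0 in H. cut (-1 * (t - 0) <= cos t - 1); [lra|]. apply H.
  - intros x _. apply is_derive_cos.
  - intros x _. destruct (SIN_bound x). lra.
Qed.

(** * Transition functions and the linear equation outside the layer *)

(** Monotonicity and saturation exactly outside (-1, 1): the form in which the phase estimates use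
    [psi]. *)
Definition step_shaped (psi : R -> R) : Prop :=
  (forall v, continuous psi v) /\
  (forall v w, v <= w -> psi v <= psi w) /\
  (forall v, 1 <= v -> psi v = 1) /\
  (forall v, v <= -1 -> psi v = -1) /\
  (forall v, -1 < v -> -1 < psi v) /\
  (forall v, v < 1 -> psi v < 1).

Lemma transition_function_step_shaped (psi : R -> R) :
  transition_function psi -> step_shaped psi.
Proof.
  intros [dpsi [d2psi [Hd [_ [_ [_ [H1 [Hm1 [Hpos _]]]]]]]]].
  assert (Hmono : forall v w, -1 <= v -> v < w -> w <= 1 -> psi v < psi w).
  { intros v w Hv Hvw Hw.
    destruct (MVT_cor2 psi dpsi v w Hvw) as [c [E Hc]].
    - intros c _. apply is_derive_Reals. apply Hd.
    - assert (0 < dpsi c) by (apply Hpos; lra). nra. }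
  assert (Hgt : forall v, -1 < v -> -1 < psi v).
  { intros v Hv. destruct (Rle_dec 1 v). { rewrite H1; lra. }
    rewrite <- (Hm1 (-1)) by lra. apply Hmono; lra. }
  assert (Hlt : forall v, v < 1 -> psi v < 1).
  { intros v Hv. destruct (Rle_dec v (-1)). { rewrite Hm1; lra. }
    rewrite <- (H1 1) by lra. apply Hmono; lra. }
  repeat split; trivial.
  - intros v. apply (ex_derive_continuous psi). exists (dpsi v). apply Hd.
  - intros v w Hvw. destruct (Req_dec v w) as [->|]; [lra|].
    destruct (Rle_dec v (-1)).
    { rewrite (Hm1 v) by lra. destruct (Rle_dec w (-1)). rewrite Hm1; lra.
      apply Rlt_le, Hgt. lra. }
    destruct (Rle_dec 1 w).
    { rewrite (H1 w) by lra. destruct (Rle_dec 1 v). rewrite H1; lra.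
      apply Rlt_le, Hlt. lra. }
    apply Rlt_le, Hmono; lra.
Qed.

(** Removing the integrated forcing leaves [g - k / w * cos (w * x)], whose derivative [- a * g] is
    at least [a] where [g <= -1]. *)
Lemma forced_below (g : R -> R) (a k w p q : R) :
  p <= q -> 0 < a -> w <> 0 ->
  (forall x, p <= x <= q -> is_derive g x (- a * g x - k * sin (w * x))) ->
  (forall x, p <= x <= q -> g x <= -1) ->
  a * (q - p) + k / w * (cos (w * q) - cos (w * p)) <= g q - g p.
Proof.
  intros Hpq Ha Hw Hd Hg.
  assert (H := increment_ge (fun x => g x - k / w * cos (w * x)) (fun x => - a * g x) a p q Hpq).
  cbv beta in H. cut (a * (q - p) <= g q - k / w * cos (w * q) - (g p - k / w * cos (w * p))); [lra|].
  apply H.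
  - intros x Hx. specialize (Hd x Hx).
    evar_last.
    + apply (is_derive_minus g (fun x => k / w * cos (w * x))). exact Hd.
      auto_derive. exact I. reflexivity.
    + unfold minus, plus, opp; simpl. field. exact Hw.
  - intros x Hx. specialize (Hg x Hx). nra.
Qed.

Lemma forced_above (g : R -> R) (a k w p q : R) :
  p <= q -> 0 < a -> w <> 0 ->
  (forall x, p <= x <= q -> is_derive g x (- a * g x - k * sin (w * x))) ->
  (forall x, p <= x <= q -> 1 <= g x) ->
  g q - g p <= - a * (q - p) + k / w * (cos (w * q) - cos (w * p)).
Proof.
  intros Hpq Ha Hw Hd Hg.
  assert (H := forced_below (fun x => - g x) a (- k) w p q Hpq Ha Hw).
  cbv beta in H. unfold Rdiv in *.
  cut (a * (q - p) + - k * / w * (cos (w * q) - cos (w * p)) <= - g q - - g p); [lra|].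
  apply H.
  - intros x Hx. evar_last. apply (is_derive_opp g). apply Hd; exact Hx.
    unfold opp; simpl. ring.
  - intros x Hx. specialize (Hg x Hx). lra.
Qed.

(** The product [d x * exp (a * x)] is constant. Here [d] will be the difference of two solutions
    with the same forcing. *)
Lemma exponential_decay (d : R -> R) (a p q : R) :
  p <= q -> (forall x, p <= x <= q -> is_derive d x (- a * d x)) ->
  d q = d p * exp (- a * (q - p)).
Proof.
  intros Hpq Hd.
  destruct (mean_value (fun x => d x * exp (a * x)) (fun _ => 0) p q Hpq) as [c [_ E]].
  - intros x Hx. evar_last.
    + apply (is_derive_mult d (fun x => exp (a * x))). apply Hd. exact Hx.
      auto_derive. exact I. reflexivity.
      intros; apply Rmult_comm.
    + unfold plus, mult; simpl. ring.
  - cbv beta in E.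
    assert (E' : d q * exp (a * q) = d p * exp (a * p)) by lra.
    replace (- a * (q - p)) with (a * p + - (a * q)) by ring.
    rewrite exp_plus, <- Rmult_assoc, <- E', Rmult_assoc, <- exp_plus.
    replace (a * q + - (a * q)) with 0 by ring. rewrite exp_0. ring.
Qed.

(** The integrating factor gives [(g + 1) * exp (a * x)] the derivative
    [(a - f) * exp (a * x) < 0]. *)
Lemma stays_below (g f : R -> R) (a p q : R) :
  p < q -> (forall x, p <= x <= q -> is_derive g x (- a * g x - f x)) ->
  (forall x, p < x < q -> a < f x) -> g p <= -1 -> g q < -1.
Proof.
  intros Hpq Hd Hf Hp.
  destruct (MVT_cor2 (fun x => (g x + 1) * exp (a * x))
              (fun x => (a - f x) * exp (a * x)) p q Hpq) as [c [E Hc]].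
  - intros x Hx. apply is_derive_Reals. evar_last.
    + apply (is_derive_mult (fun x => g x + 1) (fun x => exp (a * x))).
      * apply (is_derive_plus g (fun _ => 1)). apply Hd; exact Hx. apply is_derive_const.
      * auto_derive. exact I. reflexivity.
      * intros; apply Rmult_comm.
    + unfold plus, mult, zero; simpl. ring.
  - specialize (Hf c Hc).
    assert (0 < exp (a * p)) by apply exp_pos.
    assert (0 < exp (a * q)) by apply exp_pos.
    assert (0 < exp (a * c)) by apply exp_pos.
    assert ((a - f c) * exp (a * c) < 0) by nra.
    assert ((g q + 1) * exp (a * q) < 0) by nra.
    nra.
Qed.

(* The periodic solution of r' = - a r + sin(pi y / 2). *)
Definition forced_response (a y : R) : R :=
  (a * sin (PI * y / 2) - PI / 2 * cos (PI * y / 2)) / (a * a + PI / 2 * (PI / 2)).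

(** An antiderivative of the integrand in [s] is [exp (- a * (x - s)) * forced_response a s]. *)
Lemma vminus_closed (a eps x x0 : R) : 0 < a ->
  vminus a eps x x0 =
  - exp (- a * (x - x0))
  - / eps * (forced_response a x - exp (- a * (x - x0)) * forced_response a x0).
Proof.
  intros Ha. unfold vminus. f_equal. f_equal.
  assert (Hden : a * a + PI / 2 * (PI / 2) <> 0).
  { assert (HP := PI_RGT_0). nra. }
  replace (forced_response a x) with (exp (- a * (x - x)) * forced_response a x).
  2: { replace (- a * (x - x)) with 0 by ring. rewrite exp_0. ring. }
  apply is_RInt_unique.
  apply (is_RInt_derive (fun s => exp (- a * (x - s)) * forced_response a s)).
  - intros s _. unfold forced_response. auto_derive. exact I.
    change (x + - s) with (x - s). unfold Rdiv. simpl. field.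
    assert (HP := PI_RGT_0). nra.
  - intros s _. apply (ex_derive_continuous (fun s => exp (- a * (x - s)) * sin (PI * s / 2))).
    auto_derive. exact I.
Qed.

Lemma vminus_start (a eps x0 : R) : 0 < a -> vminus a eps x0 x0 = -1.
Proof.
  intros Ha. rewrite vminus_closed by assumption.
  replace (- a * (x0 - x0)) with 0 by ring. rewrite exp_0. ring.
Qed.

Lemma vminus_derive (a eps x x0 : R) : 0 < a -> 0 < eps ->
  is_derive (fun x => vminus a eps x x0) x
    (- a * vminus a eps x x0 - sin (PI * (x / 2)) / eps).
Proof.
  intros Ha He.
  apply (is_derive_ext (fun x => - exp (- a * (x - x0))
    - / eps * (forced_response a x - exp (- a * (x - x0)) * forced_response a x0))).
  { intros t. symmetry. apply vminus_closed. exact Ha. }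
  rewrite vminus_closed by assumption.
  set (c := forced_response a x0). unfold forced_response.
  assert (HP := PI_RGT_0).
  auto_derive. exact I.
  change (x + - x0) with (x - x0).
  replace (PI * (x / 2)) with (PI * x / 2) by field. unfold Rdiv.
  field. split; nra.
Qed.

Lemma vminus_shift (a eps x x0 : R) (n : Z) : 0 < a ->
  vminus a eps (4 * IZR n + x) (4 * IZR n + x0) = vminus a eps x x0.
Proof.
  intros Ha. rewrite !vminus_closed by assumption.
  assert (E : forall y, forced_response a (4 * IZR n + y) = forced_response a y).
  { intros y. unfold forced_response.
    replace (PI * (4 * IZR n + y) / 2) with (PI * y / 2 + 2 * IZR n * PI) by field.
    rewrite sin_period_Z, cos_period_Z. reflexivity. }
  rewrite !E. replace (4 * IZR n + x - (4 * IZR n + x0)) with (x - x0) by ring.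
  reflexivity.
Qed.

(** * Folds and the first return *)

(** The bounds 1/48 and 1/4 make [v] fall at a rate at least 12 inside a band of phases; the sine
    bound keeps each fold within 1/8 of [4 n]. *)
Definition small_parameter (a eps : R) : Prop :=
  0 < a /\ 0 < eps <= / 48 /\ a * eps <= / 4 /\ a * eps <= sin (PI / 16).

Definition fold_phase (a eps : R) : R := 2 / PI * asin (a * eps).

Lemma fold_phase_spec (a eps : R) : small_parameter a eps ->
  0 < fold_phase a eps <= / 8 /\ sin (PI * (fold_phase a eps / 2)) = a * eps.
Proof.
  intros [Ha [[He _] [Hq Hs]]]. assert (HP := PI_RGT_0).
  assert (Hae : 0 < a * eps) by nra.
  assert (Hsin : sin (asin (a * eps)) = a * eps) by (apply sin_asin; lra).
  assert (Hb := asin_bound (a * eps)).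
  unfold fold_phase.
  replace (PI * (2 / PI * asin (a * eps) / 2)) with (asin (a * eps)) by (field; lra).
  assert (H0 : 0 < asin (a * eps)).
  { apply sin_increasing_0; try lra. rewrite sin_0, Hsin. exact Hae. }
  assert (H1 : asin (a * eps) <= PI / 16).
  { apply sin_incr_0; try lra. }
  assert (Hi : 0 < / PI) by (apply Rinv_0_lt_compat; lra).
  split; [|exact Hsin]. split.
  - unfold Rdiv. apply Rmult_lt_0_compat; lra.
  - apply Rle_trans with (2 / PI * (PI / 16)).
    + apply Rmult_le_compat_l; [|exact H1]. unfold Rdiv. lra.
    + right. field. lra.
Qed.

(** At [v = -1] the damping contributes [+ a], so the field points down where the forcing exceeds
    [a]. The two coincide at the fold phase. *)
Lemma drift_gt_of_phase (a eps t : R) (m : Z) : small_parameter a eps ->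
  2 * IZR m + fold_phase a eps / 2 < t < 2 * IZR m + 1 - fold_phase a eps / 2 ->
  a < sin (PI * t) / eps.
Proof.
  intros Hs Ht. destruct (fold_phase_spec a eps Hs) as [Hphi Hsin].
  destruct Hs as [Ha [He _]]. assert (HP := PI_RGT_0).
  apply Rmult_lt_reg_r with eps; [lra|].
  unfold Rdiv. rewrite Rmult_assoc, Rinv_l, Rmult_1_r, <- Hsin by lra.
  set (r := Rmin (/ 2) (Rmin (t - 2 * IZR m) (2 * IZR m + 1 - t))).
  assert (H1 : r <= / 2) by apply Rmin_l.
  assert (H2 : r <= Rmin (t - 2 * IZR m) (2 * IZR m + 1 - t)) by apply Rmin_r.
  assert (H3 := Rmin_l (t - 2 * IZR m) (2 * IZR m + 1 - t)).
  assert (H4 := Rmin_r (t - 2 * IZR m) (2 * IZR m + 1 - t)).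
  assert (H5 : fold_phase a eps / 2 < r) by (repeat apply Rmin_glb_lt; lra).
  apply Rlt_le_trans with (sin (PI * r)).
  - apply sin_increasing_1; nra.
  - apply (sin_phase_ge _ _ m); lra.
Qed.

Lemma drift_le_of_phase (a eps t : R) (m : Z) : small_parameter a eps ->
  2 * IZR m - 1 - fold_phase a eps / 2 <= t <= 2 * IZR m + fold_phase a eps / 2 ->
  sin (PI * t) / eps <= a.
Proof.
  intros Hs Ht. destruct (fold_phase_spec a eps Hs) as [Hphi Hsin].
  destruct Hs as [Ha [He _]].
  apply Rmult_le_reg_r with eps; [lra|].
  unfold Rdiv. rewrite Rmult_assoc, Rinv_l, Rmult_1_r, <- Hsin by lra.
  apply (sin_phase_le _ _ m); lra.
Qed.

Lemma drift_abs_le (a eps t : R) : small_parameter a eps ->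
  - / eps <= sin (PI * t) / eps <= / eps.
Proof.
  intros [_ [He _]]. destruct (SIN_bound (PI * t)).
  assert (0 < / eps) by (apply Rinv_0_lt_compat; lra). unfold Rdiv. split; nra.
Qed.

Lemma linear_falls_after_fold (a eps : R) (g : R -> R) (n : Z) (p q : R) :
  small_parameter a eps -> xfold a eps n <= p -> p < q ->
  q <= 4 * IZR n + 2 - fold_phase a eps ->
  (forall x, p <= x <= q -> is_derive g x (- a * g x - sin (PI * (x / 2)) / eps)) ->
  g p <= -1 -> g q < -1.
Proof.
  intros Hsmall Hp Hpq Hq Hd.
  apply (stays_below g (fun x => sin (PI * (x / 2)) / eps) a p q Hpq Hd).
  intros x Hx. apply drift_gt_of_phase with n; [exact Hsmall|].
  change (xfold a eps n) with (4 * IZR n + fold_phase a eps) in Hp. lra.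
Qed.

(** The forcing is at most [a] here, while the damping contributes at least [a] as long as
    [g <= -1]. *)
Lemma linear_rises_before_fold (a eps : R) (g : R -> R) (n : Z) (p q : R) :
  small_parameter a eps -> 4 * IZR n - 2 - fold_phase a eps <= p -> p <= q ->
  q <= xfold a eps n ->
  (forall x, p <= x <= q -> is_derive g x (- a * g x - sin (PI * (x / 2)) / eps)) ->
  (forall x, p <= x <= q -> g x <= -1) -> g p <= g q.
Proof.
  intros Hsmall Hp Hpq Hq Hd Hg.
  cut (0 * (q - p) <= g q - g p); [lra|].
  apply (increment_ge g (fun x => - a * g x - sin (PI * (x / 2)) / eps)); [exact Hpq|exact Hd|].
  intros x Hx. specialize (Hg x Hx).
  change (xfold a eps n) with (4 * IZR n + fold_phase a eps) in Hq.
  assert (sin (PI * (x / 2)) / eps <= a) by (apply drift_le_of_phase with n; [exact Hsmall|lra]).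
  destruct Hsmall as [Ha _]. nra.
Qed.

Lemma xfold_succ (a eps : R) (n : Z) : xfold a eps (n + 1) = xfold a eps n + 4.
Proof. unfold xfold. rewrite plus_IZR. ring. Qed.

(** Modulo the period the argument lies in the half period on which cosine decreases, and the next
    fold corresponds to the left end of its range. *)
Lemma cos_le_cos_fold (a eps x : R) (n : Z) : small_parameter a eps ->
  xfold a eps n <= x <= 4 * IZR n + 2 - fold_phase a eps ->
  cos (PI / 2 * x) <= cos (PI / 2 * xfold a eps (n + 1)).
Proof.
  intros Hs Hx. destruct (fold_phase_spec a eps Hs) as [Hphi _]. assert (HP := PI_RGT_0).
  rewrite xfold_succ.
  change (xfold a eps n) with (4 * IZR n + fold_phase a eps) in *.
  replace (PI / 2 * (4 * IZR n + fold_phase a eps + 4))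
    with (PI * (fold_phase a eps / 2) + 2 * IZR (n + 1) * PI) by (rewrite plus_IZR; field).
  replace (PI / 2 * x) with (PI * (x / 2 - 2 * IZR n) + 2 * IZR n * PI) by field.
  rewrite !cos_period_Z. apply cos_decr_1; nra.
Qed.

Lemma linear_form (g : R -> R) (a eps x : R) :
  is_derive g x (- a * g x - sin (PI * (x / 2)) / eps) ->
  is_derive g x (- a * g x - / eps * sin (PI / 2 * x)).
Proof.
  intros H. evar_last. exact H.
  replace (PI / 2 * x) with (PI * (x / 2)) by field. unfold Rdiv. ring.
Qed.

(* The forcing over [p, next fold] integrates to a nonnegative amount, so the damping towards 0 wins. *)
Lemma linear_returns (a eps : R) (g : R -> R) (n : Z) (p : R) :
  small_parameter a eps -> xfold a eps n <= p -> p <= 4 * IZR n + 2 - fold_phase a eps ->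
  (forall x, p <= x <= xfold a eps (n + 1) ->
     is_derive g x (- a * g x - sin (PI * (x / 2)) / eps)) ->
  (forall x, p <= x <= xfold a eps (n + 1) -> g x <= -1) ->
  g p + a * (xfold a eps (n + 1) - p) <= g (xfold a eps (n + 1)).
Proof.
  intros Hs Hp Hq Hd Hg. destruct (fold_phase_spec a eps Hs) as [Hphi _].
  assert (HP := PI_RGT_0).
  assert (Hcos := cos_le_cos_fold a eps p n Hs (conj Hp Hq)).
  assert (Hn := xfold_succ a eps n).
  destruct Hs as [Ha [He _]].
  assert (H := forced_below g a (/ eps) (PI / 2) p (xfold a eps (n + 1))).
  assert (0 <= / eps / (PI / 2)).
  { apply Rlt_le, Rdiv_lt_0_compat; [apply Rinv_0_lt_compat|]; lra. }
  cut (a * (xfold a eps (n + 1) - p) + / eps / (PI / 2) *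
    (cos (PI / 2 * xfold a eps (n + 1)) - cos (PI / 2 * p)) <= g (xfold a eps (n + 1)) - g p).
  { nra. }
  change (xfold a eps n) with (4 * IZR n + fold_phase a eps) in *.
  apply H; try lra.
  - intros x Hx. apply linear_form. apply Hd. exact Hx.
  - exact Hg.
Qed.

(** The solution is below -1 until [B], where the forcing is back at [a]. It returns by [F + 4],
    since a whole period below -1 would raise it by [4 a]. *)
Lemma first_return_exists (a eps : R) : small_parameter a eps ->
  exists xa, first_return a eps xa /\ 2 - 2 * fold_phase a eps <= xa <= 4 /\
    forall x, 0 <= x <= xa ->
      vminus a eps (xfold a eps 0 + x) (xfold a eps 0) <= -1.
Proof.
  intros Hs. destruct (fold_phase_spec a eps Hs) as [Hphi _].
  assert (Hs' := Hs). destruct Hs' as [Ha [He _]].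
  set (F := xfold a eps 0). set (V := fun x => vminus a eps x F).
  assert (HF : F = fold_phase a eps).
  { unfold F. change (xfold a eps 0) with (4 * 0 + fold_phase a eps). ring. }
  assert (HF4 : xfold a eps (0 + 1) = F + 4) by apply xfold_succ.
  assert (Hd : forall x, is_derive V x (- a * V x - sin (PI * (x / 2)) / eps)).
  { intros x. apply vminus_derive; lra. }
  assert (Hc : forall x, continuous V x).
  { intros x. apply (ex_derive_continuous V). eexists. apply Hd. }
  assert (V0 : V F = -1) by (apply vminus_start; exact Ha).
  set (B := 2 - fold_phase a eps).
  assert (HB : forall x, F < x <= B -> V x < -1).
  { intros x Hx. apply (linear_falls_after_fold a eps V 0 F x); try lra; try assumption.
    - unfold F. lra.
    - unfold B in Hx. lra.
    - intros; apply Hd. }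
  assert (HV4 : -1 <= V (F + 4)).
  { apply Rnot_lt_le. intros H4.
    assert (Hall : forall x, F <= x <= F + 4 -> V x <= -1).
    { intros x Hx. destruct (Req_dec x F) as [->|]; [lra|].
      destruct (Rle_dec x B). { apply Rlt_le, HB. lra. }
      (* Beyond [B], a value above -1 would force a last passage down through -1, after which [V]
         cannot decrease before the next fold. *)
      apply Rnot_lt_le. intros Hlt.
      destruct (last_hit_down V x (F + 4) (-1)) as [r [Hr [Er Hr4]]]; try lra.
      { intros; apply Hc. }
      assert (V r <= V (F + 4)); [|lra].
      apply (linear_rises_before_fold a eps V (0 + 1)); try lra; try assumption.
      - rewrite plus_IZR. unfold B in *. lra.
      - intros; apply Hd. }
    assert (H := linear_returns a eps V 0 F Hs). rewrite HF4 in H.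
    cut (V F + a * (F + 4 - F) <= V (F + 4)); [nra|].
    apply H; try lra.
    - unfold F. lra.
    - intros; apply Hd.
    - exact Hall. }
  assert (VB : V B < -1). { apply HB. unfold B. lra. }
  destruct (first_hit_strict V B (F + 4) (-1)) as [r [Hr [Er Hbelow]]]; try lra.
  { unfold B. lra. }
  { intros; apply Hc. }
  assert (HBF : B = F + (2 - 2 * fold_phase a eps)) by (unfold B; lra).
  assert (Hlt : forall x, F < x < r -> V x < -1).
  { intros x Hx. destruct (Rle_dec x B); [apply HB|apply Hbelow]; lra. }
  exists (r - F). split; [split; [lra|split]|split; [lra|]].
  - fold F. replace (F + (r - F)) with r by ring. exact Er.
  - intros y Hy. fold F. specialize (Hlt (F + y) ltac:(lra)). unfold V in Hlt. lra.
  - intros x Hx. fold F. change (V (F + x) <= -1).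
    destruct (Req_dec x 0) as [->|]. { rewrite Rplus_0_r. lra. }
    destruct (Req_dec x (r - F)) as [->|].
    { replace (F + (r - F)) with r by ring. lra. }
    apply Rlt_le, Hlt. lra.
Qed.

(** * Trajectories of the regularized system *)

Section StepShaped.

Variable psi : R -> R.
Hypothesis Hpsi : step_shaped psi.

Lemma step_bounds (w : R) : -1 <= psi w <= 1.
Proof.
  destruct Hpsi as [_ [_ [H1 [Hm1 [Hgt Hlt]]]]]. split.
  - destruct (Rle_dec w (-1)). rewrite Hm1; lra. apply Rlt_le, Hgt. lra.
  - destruct (Rle_dec 1 w). rewrite H1; lra. apply Rlt_le, Hlt. lra.
Qed.

(** For [w >= -1 + d] the phase exceeds [x / 2] by at least [x * k / 2], which is more than 2 once
    [x >= 5 / k]. *)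
Lemma eventually_near_bottom (d : R) : 0 < d ->
  exists X, 0 < X /\ forall x w, X <= x ->
    x * (1 + psi w / 2) <= x / 2 + 2 -> w < -1 + d.
Proof.
  intros Hd. destruct Hpsi as [_ [Hmono [_ [_ [Hgt _]]]]].
  set (k := 1 + psi (-1 + d)).
  assert (Hk : 0 < k). { unfold k. specialize (Hgt (-1 + d) ltac:(lra)). lra. }
  exists (5 / k). split. { apply Rdiv_lt_0_compat; lra. }
  intros x w Hx H. apply Rnot_le_lt. intros Hw.
  specialize (Hmono _ _ Hw). fold k in Hmono.
  assert (5 <= x * k).
  { apply Rmult_le_compat_r with (r := k) in Hx; [|lra].
    replace (5 / k * k) with 5 in Hx by (field; lra). exact Hx. }
  assert (0 < x). { apply Rlt_le_trans with (2 := Hx). apply Rdiv_lt_0_compat; lra. }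
  assert (x * k <= x * (1 + psi w)) by (apply Rmult_le_compat_l; unfold k; lra). lra.
Qed.

Lemma eventually_near_top (d : R) : 0 < d ->
  exists X, 0 < X /\ forall x w, X <= x ->
    3 * x / 2 - 2 <= x * (1 + psi w / 2) -> 1 - d < w.
Proof.
  intros Hd. destruct Hpsi as [_ [Hmono [_ [_ [_ Hlt]]]]].
  set (k := 1 - psi (1 - d)).
  assert (Hk : 0 < k). { unfold k. specialize (Hlt (1 - d) ltac:(lra)). lra. }
  exists (5 / k). split. { apply Rdiv_lt_0_compat; lra. }
  intros x w Hx H. apply Rnot_le_lt. intros Hw.
  specialize (Hmono _ _ Hw).
  assert (5 <= x * k).
  { apply Rmult_le_compat_r with (r := k) in Hx; [|lra].
    replace (5 / k * k) with 5 in Hx by (field; lra). exact Hx. }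
  assert (0 < x). { apply Rlt_le_trans with (2 := Hx). apply Rdiv_lt_0_compat; lra. }
  assert (x * k <= x * (1 - psi w)) by (apply Rmult_le_compat_l; unfold k; lra). lra.
Qed.

(** * The phase along a trajectory and the bands that stop it *)

Variables (a eps x0 : R) (v : R -> R).
Hypothesis Hsmall : small_parameter a eps.
Hypothesis Htraj : trajectory psi a eps x0 v.

Local Notation phi := (fold_phase a eps).

Definition phase (x : R) : R := x * (1 + psi (v x) / 2).

Lemma trajectory_derive (x : R) : x0 < x ->
  is_derive v x (- a * v x - sin (PI * phase x) / eps).
Proof.
  intros Hx. evar_last. apply Htraj. exact Hx.
  unfold rhs, phase.
  replace (PI * x * (1 + psi (v x) / 2)) with (PI * (x * (1 + psi (v x) / 2))) by ring.
  field.
  destruct Hsmall as [_ [He _]]. lra.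
Qed.

Lemma trajectory_continuous (x : R) : x0 < x -> continuous v x.
Proof.
  intros Hx. apply (ex_derive_continuous v). eexists. apply trajectory_derive. exact Hx.
Qed.

Lemma phase_continuous (x : R) : x0 < x -> continuous phase x.
Proof.
  intros Hx. unfold phase.
  apply (continuous_mult (fun y : R => y) (fun y => 1 + psi (v y) / 2)).
  apply continuous_id.
  apply (continuous_plus (fun _ => 1) (fun y => psi (v y) / 2)).
  apply continuous_const.
  apply (continuous_mult (fun y => psi (v y)) (fun _ => / 2)).
  - apply (continuous_comp v psi). apply trajectory_continuous. exact Hx. apply Hpsi.
  - apply continuous_const.
Qed.

Lemma phase_bounds (x : R) : 0 < x -> x / 2 <= phase x <= 3 * x / 2.
Proof.
  intros Hx. destruct (step_bounds (v x)). unfold phase. split; nra.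
Qed.

Lemma phase_below (x : R) : v x <= -1 -> phase x = x / 2.
Proof.
  intros H. unfold phase. destruct Hpsi as [_ [_ [_ [Hm1 _]]]]. rewrite Hm1 by exact H. field.
Qed.

Lemma phase_above (x : R) : 1 <= v x -> phase x = 3 * x / 2.
Proof.
  intros H. unfold phase. destruct Hpsi as [_ [_ [H1 _]]]. rewrite H1 by exact H. field.
Qed.

Lemma above_bottom_of_phase (x : R) : x / 2 < phase x -> -1 < v x.
Proof.
  intros H. apply Rnot_le_lt. intros H1. rewrite phase_below in H; lra.
Qed.

Lemma below_top_of_phase (x : R) : phase x < 3 * x / 2 -> v x < 1.
Proof.
  intros H. apply Rnot_le_lt. intros H1. rewrite phase_above in H; lra.
Qed.

(** The factor [1 + psi v / 2] is no larger at [x] than at [z], and it is at most 3/2. *)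
Lemma phase_growth (z x : R) : 0 < z -> z <= x -> v x <= v z ->
  phase x - phase z <= 3 / 2 * (x - z).
Proof.
  intros Hz Hzx Hv. unfold phase.
  destruct Hpsi as [_ [Hmono _]]. specialize (Hmono _ _ Hv).
  destruct (step_bounds (v z)). nra.
Qed.

(* Crossing the band [2m + 1/4, 2m + 1/2] of phases takes a time at least 1/6, and
   in that band v falls at a rate at least 1 / (4 eps) >= 12, so it would fall by 2. *)
Lemma phase_barrier (m : Z) (y x : R) : x0 < y -> 0 < y ->
  v y <= 1 -> phase y <= 2 * IZR m + / 4 -> 2 * IZR m + / 4 <= 3 * y / 2 ->
  y <= x -> x < 4 * IZR m + / 2 -> phase x < 2 * IZR m + / 2.
Proof.
  intros Hy0 Hy Hvy Hpy Hmy Hyx Hxm. apply Rnot_le_lt. intros Hpx.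
  (* Last time [z] at the lower edge, then first time [w] at the upper edge: in between the phase
     stays in the band. *)
  destruct (last_hit phase y x (2 * IZR m + / 4)) as [z [Hz [Ez Hzx]]]; try lra.
  { intros w Hw. apply phase_continuous. lra. }
  destruct (first_hit phase z x (2 * IZR m + / 2)) as [w [Hw [Ew Hzw]]]; try lra.
  { intros w Hw. apply phase_continuous. lra. }
  destruct Hsmall as [Ha [He [Hae _]]].
  assert (Hrate : a - / 2 * / eps <= - 12).
  { apply Rmult_le_reg_r with eps; [lra|].
    replace ((a - / 2 * / eps) * eps) with (a * eps - / 2) by (field; lra). lra. }
  (* Since [t / 2] is below the lower edge, a phase in the band excludes [v t <= -1]. *)
  assert (Hbot : forall t, z <= t <= w -> -1 < v t).
  { intros t Ht. apply above_bottom_of_phase. specialize (Hzx t ltac:(lra)). lra. }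
  assert (Hdrop : v w - v z <= - 12 * (w - z)).
  { apply (increment_le v (fun t => - a * v t - sin (PI * phase t) / eps)); [lra| |].
    - intros t Ht. apply trajectory_derive. lra.
    - intros t Ht. specialize (Hbot t Ht).
      specialize (Hzx t ltac:(lra)). specialize (Hzw t Ht).
      assert (Hs := half_le_sin (phase t) m ltac:(lra)).
      assert (0 < / eps) by (apply Rinv_0_lt_compat; lra).
      assert (/ 2 * / eps <= sin (PI * phase t) * / eps) by (apply Rmult_le_compat_r; lra).
      unfold Rdiv. nra. }
  assert (Hg := phase_growth z w ltac:(lra) ltac:(lra) ltac:(lra)).
  (* If [z > y], then [3 z / 2] is strictly above the lower edge, so [psi] is not saturated at 1. *)
  assert (Htop : v z <= 1).
  { destruct (Req_dec z y) as [->|Hne]; [exact Hvy|].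
    apply Rlt_le, below_top_of_phase. lra. }
  specialize (Hbot w ltac:(lra)). lra.
Qed.

Lemma linear_below (x : R) : x0 < x -> v x <= -1 ->
  is_derive v x (- a * v x - sin (PI * (x / 2)) / eps).
Proof.
  intros Hx H. rewrite <- (phase_below x H). apply trajectory_derive. exact Hx.
Qed.

(** Up to a first return to -1 the equation is the linear one, which forbids that return. *)
Lemma falls_after_fold (n : Z) (p q : R) : x0 < p ->
  xfold a eps n <= p -> p <= q -> q <= 4 * IZR n + 2 - phi ->
  v p < -1 -> v q < -1.
Proof.
  intros Hp0 Hp Hpq Hq Hvp. apply Rnot_le_lt. intros Hvq.
  destruct (first_hit v p q (-1)) as [r [Hr [Er Hpr]]]; try lra.
  { intros x Hx. apply trajectory_continuous. lra. }
  assert (Hpr' : p < r). { destruct (Req_dec p r) as [E|Hne]; [rewrite E in Hvp|]; lra. }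
  assert (H : v r < -1); [|lra].
  apply (linear_falls_after_fold a eps v n p r); try lra; try assumption.
  intros x Hx. apply linear_below. lra. apply Hpr. exact Hx.
Qed.

(** After a last passage down through -1 the equation is linear and its solution cannot decrease
    before the fold. *)
Lemma stays_above_before_fold (n : Z) (p q : R) : x0 < p ->
  4 * IZR n - 2 - phi <= p -> p <= q -> q <= xfold a eps n ->
  -1 <= v p -> -1 <= v q.
Proof.
  intros Hp0 Hp Hpq Hq Hvp. apply Rnot_lt_le. intros Hvq.
  destruct (last_hit_down v p q (-1)) as [r [Hr [Er Hrq]]]; try lra.
  { intros x Hx. apply trajectory_continuous. lra. }
  assert (v r <= v q); [|lra].
  apply (linear_rises_before_fold a eps v n); try lra; try assumption.
  intros x Hx. apply linear_below. lra. apply Hrq. exact Hx.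
Qed.

Lemma xfold_eq (n : Z) : xfold a eps n = 4 * IZR n + phi.
Proof. reflexivity. Qed.

(** * From one fold to the next *)

(* The state that propagates from one fold to the next. *)
Definition captured (n : Z) : Prop :=
  -1 <= v (xfold a eps n) /\ phase (xfold a eps n) < 2 * IZR n + / 2.

Lemma nonneg_of_fold (n : Z) : 0 < xfold a eps n -> 0 <= IZR n.
Proof.
  intros H. rewrite xfold_eq in H. destruct (fold_phase_spec a eps Hsmall) as [Hphi _].
  apply IZR_le. assert (-1 < n)%Z; [|lia]. apply lt_IZR. lra.
Qed.

(** With the phase between [x / 2] and [2 n + 3/4], the sine is at least its value at [phi / 2 + s].
    For [s = 0] the resulting bound on the rate is exactly 0. *)
Lemma captured_falls (n : Z) (p q s : R) :
  x0 < p -> 0 <= s <= / 8 ->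
  xfold a eps n + 2 * s <= p -> p <= q ->
  (forall x, p <= x <= q -> x / 2 <= phase x) ->
  (forall x, p <= x <= q -> -1 <= v x) ->
  (forall x, p <= x <= q -> phase x <= 2 * IZR n + 3 / 4) ->
  v q - v p <= (a - sin (PI * (phi / 2 + s)) / eps) * (q - p).
Proof.
  intros Hp0 Hs Hp Hpq Hlow Hv Hph.
  apply (increment_le v (fun x => - a * v x - sin (PI * phase x) / eps)); [exact Hpq| |].
  - intros x Hx. apply trajectory_derive. lra.
  - intros x Hx. specialize (Hv x Hx). specialize (Hph x Hx).
    rewrite xfold_eq in Hp. specialize (Hlow x Hx).
    destruct (fold_phase_spec a eps Hsmall) as [Hphi _].
    assert (Hsin : sin (PI * (phi / 2 + s)) <= sin (PI * phase x)).
    { apply (sin_phase_ge _ _ n); lra. }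
    destruct Hsmall as [Ha [He _]].
    assert (0 < / eps) by (apply Rinv_0_lt_compat; lra).
    assert (sin (PI * (phi / 2 + s)) / eps <= sin (PI * phase x) / eps).
    { unfold Rdiv. apply Rmult_le_compat_r; lra. }
    nra.
Qed.

Lemma captured_falls_weakly (n : Z) (p q : R) :
  x0 < p -> xfold a eps n <= p -> p <= q ->
  (forall x, p <= x <= q -> x / 2 <= phase x) ->
  (forall x, p <= x <= q -> -1 <= v x) ->
  (forall x, p <= x <= q -> phase x <= 2 * IZR n + 3 / 4) ->
  v q <= v p.
Proof.
  intros Hp0 Hp Hpq Hlow Hv Hph.
  assert (H := captured_falls n p q 0 Hp0 ltac:(lra) ltac:(lra) Hpq Hlow Hv Hph).
  destruct (fold_phase_spec a eps Hsmall) as [_ Hsin].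
  rewrite Rplus_0_r, Hsin in H. destruct Hsmall as [Ha [He _]].
  replace (a * eps / eps) with a in H by (field; lra). lra.
Qed.

(** Until the phase first reaches [2 n + 3/4], [v] does not increase, so the phase gains at most
    [3/2 * 1/8 < 1/4] over its initial value below [2 n + 1/2]. *)
Lemma captured_phase (n : Z) (q : R) : x0 < xfold a eps n -> 0 < xfold a eps n ->
  captured n -> xfold a eps n <= q <= xfold a eps n + / 8 ->
  (forall x, xfold a eps n <= x <= q -> -1 <= v x) ->
  phase q <= 2 * IZR n + 3 / 4.
Proof.
  intros H0 Hpos [_ Hc] Hq Hv. apply Rnot_lt_le. intros Hlt.
  destruct (first_hit phase (xfold a eps n) q (2 * IZR n + 3 / 4)) as [r [Hr [Er Hbelow]]];
    try lra.
  { intros x Hx. apply phase_continuous. lra. }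
  assert (Hfall : v r <= v (xfold a eps n)).
  { apply (captured_falls_weakly n); try lra.
    - intros x Hx. apply phase_bounds. lra.
    - intros x Hx. apply Hv. lra.
    - exact Hbelow. }
  assert (Hg := phase_growth (xfold a eps n) r Hpos ltac:(lra) Hfall). lra.
Qed.

(** At a late fold [v] is less than [g * d / 2] above -1. Staying at or above -1 through the window
    would cost at least that much in its second half. *)
Lemma leaves_at_fold (d : R) : 0 < d <= / 8 ->
  exists X, x0 < X /\ 0 < X /\ forall n, X <= xfold a eps n -> captured n ->
    v (xfold a eps n + d) < -1 /\
    forall x, xfold a eps n <= x <= xfold a eps n + d -> v x < -1 + d.
Proof.
  intros Hd. destruct (fold_phase_spec a eps Hsmall) as [Hphi Hsin].
  (* From time [F + d / 2] on, [x / 2] is at least [2 n + phi / 2 + d / 4]; [g] is the resulting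
     rate of fall. *)
  set (g := sin (PI * (phi / 2 + d / 4)) / eps - a).
  assert (Hg : 0 < g).
  { unfold g. assert (a < sin (PI * (phi / 2 + d / 4)) / eps); [|lra].
    apply drift_gt_of_phase with 0%Z; [exact Hsmall|]. lra. }
  assert (He : 0 < Rmin d (g * (d / 2))) by (apply Rmin_glb_lt; nra).
  assert (H1 := Rmin_l d (g * (d / 2))).
  assert (H2 := Rmin_r d (g * (d / 2))).
  destruct (eventually_near_bottom _ He) as [X [HX Hnear]].
  exists (Rmax X (x0 + 1)).
  assert (HX1 := Rmax_l X (x0 + 1)). assert (HX2 := Rmax_r X (x0 + 1)).
  split; [lra|]. split; [lra|].
  intros n Hn Hc. assert (Hc' := Hc). destruct Hc' as [Hc1 Hc2].
  set (F := xfold a eps n) in *.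
  assert (HF : F = 4 * IZR n + phi) by reflexivity.
  assert (Hstart : v F < -1 + Rmin d (g * (d / 2))).
  { apply Hnear with F; [lra|]. fold (phase F). lra. }
  (* Once below -1, [v] cannot come back within the window. *)
  assert (Habove : forall q, F <= q <= F + d -> -1 <= v q ->
            forall x, F <= x <= q -> -1 <= v x).
  { intros q Hq Hvq x Hx. apply Rnot_lt_le. intros Hlt.
    assert (v q < -1); [|lra].
    apply (falls_after_fold n x q); try (fold F); lra. }
  assert (Hphase : forall q, F <= q <= F + d -> -1 <= v q ->
            forall x, F <= x <= q -> phase x <= 2 * IZR n + 3 / 4).
  { intros q Hq Hvq x Hx. apply captured_phase; try (fold F); try lra.
    - exact Hc.
    - intros y Hy. apply (Habove q); try lra. }
  assert (Hlow : forall x, F <= x -> x / 2 <= phase x).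
  { intros x Hx. apply phase_bounds. lra. }
  split.
  - apply Rnot_le_lt. intros Hvq.
    specialize (Habove (F + d) ltac:(lra) Hvq).
    specialize (Hphase (F + d) ltac:(lra) Hvq).
    assert (Hf1 : v (F + d / 2) <= v F).
    { apply (captured_falls_weakly n); try (fold F); try lra;
        intros x Hx; [apply Hlow|apply Habove|apply Hphase]; lra. }
    assert (Hf2 : v (F + d) - v (F + d / 2)
      <= (a - sin (PI * (phi / 2 + d / 4)) / eps) * (F + d - (F + d / 2))).
    { apply (captured_falls n); try (fold F); try lra;
        intros x Hx; [apply Hlow|apply Habove|apply Hphase]; lra. }
    replace (a - sin (PI * (phi / 2 + d / 4)) / eps) with (- g) in Hf2 by (unfold g; ring).
    lra.
  - intros x Hx. destruct (Rlt_dec (v x) (-1)) as [Hlt|Hge]; [lra|].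
    specialize (Habove x Hx ltac:(lra)). specialize (Hphase x Hx ltac:(lra)).
    assert (v x <= v F); [|lra].
    apply (captured_falls_weakly n); try (fold F); try lra;
      intros y Hy; [apply Hlow|apply Habove|apply Hphase]; lra.
Qed.

(** Damping only helps when [v <= 0]. Together with its analogue for [vminus], this keeps both
    functions close to -1 just after a fold. *)
Lemma slow_fall (p x : R) : x0 < p -> p <= x -> -1 <= v p ->
  (forall y, p <= y <= x -> v y <= 0) -> -1 - (x - p) / eps <= v x.
Proof.
  intros Hp Hpx Hvp Hv.
  assert (H : - / eps * (x - p) <= v x - v p).
  { apply (increment_ge v (fun y => - a * v y - sin (PI * phase y) / eps)); [exact Hpx| |].
    - intros y Hy. apply trajectory_derive. lra.
    - intros y Hy. specialize (Hv y Hy).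
      assert (Hs := drift_abs_le a eps (phase y) Hsmall). destruct Hsmall as [Ha _]. nra. }
  unfold Rdiv. lra.
Qed.

Lemma vminus_slow_fall (p x : R) : p <= x ->
  (forall y, p <= y <= x -> vminus a eps y p <= -1) ->
  -1 - (x - p) / eps <= vminus a eps x p.
Proof.
  intros Hpx Hv. destruct Hsmall as [Ha [He _]].
  assert (H : - / eps * (x - p) <= vminus a eps x p - vminus a eps p p).
  { apply (increment_ge (fun y => vminus a eps y p)
             (fun y => - a * vminus a eps y p - sin (PI * (y / 2)) / eps)); [exact Hpx| |].
    - intros y Hy. apply vminus_derive; lra.
    - intros y Hy. specialize (Hv y Hy).
      assert (Hs := drift_abs_le a eps (y / 2) Hsmall). nra. }
  rewrite vminus_start in H by exact Ha. unfold Rdiv. lra.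
Qed.

Lemma captured_by_next_fold (n : Z) : x0 < xfold a eps n -> 0 < xfold a eps n ->
  v (4 * IZR n + 2 - phi) <= -1 ->
  forall x, 4 * IZR n + 2 - phi <= x <= xfold a eps (n + 1) ->
  phase x < 2 * IZR (n + 1) + / 2.
Proof.
  intros H0 Hpos HB x Hx. destruct (fold_phase_spec a eps Hsmall) as [Hphi _].
  assert (Hn := nonneg_of_fold n Hpos).
  rewrite xfold_succ, xfold_eq in *.
  (* Here [v <= -1] gives the phase [2 n + 1 - phi / 2], below the next band; [n >= 0] puts the
     lower edge of that band below 3/2 times this time. *)
  apply (phase_barrier (n + 1) (4 * IZR n + 2 - phi) x); rewrite ?plus_IZR; try lra.
  rewrite phase_below by exact HB. lra.
Qed.

(** After a last passage [p] down to -1, either [p] is in the falling stretch and the balance up to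
    the next fold is positive, or [v] can only rise. *)
Lemma returns_by_next_fold (n : Z) : x0 < xfold a eps n -> 0 < xfold a eps n ->
  -1 <= v (xfold a eps n) -> -1 <= v (xfold a eps (n + 1)).
Proof.
  intros H0 Hpos Hv. destruct (fold_phase_spec a eps Hsmall) as [Hphi _].
  assert (HF := xfold_succ a eps n).
  apply Rnot_lt_le. intros Hlt.
  destruct (last_hit_down v (xfold a eps n) (xfold a eps (n + 1)) (-1)) as [p [Hp [Ep Hbelow]]];
    try lra.
  { intros x Hx. apply trajectory_continuous. lra. }
  destruct (Rle_dec p (4 * IZR n + 2 - phi)) as [Hle|Hgt].
  - assert (H := linear_returns a eps v n p Hsmall ltac:(lra) Hle).
    assert (v p + a * (xfold a eps (n + 1) - p) <= v (xfold a eps (n + 1))).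
    { apply H; [|exact Hbelow]. intros x Hx. apply linear_below. lra. apply Hbelow. exact Hx. }
    destruct Hsmall as [Ha _]. assert (p <= xfold a eps n + 2) by (rewrite xfold_eq; lra). nra.
  - assert (-1 <= v (xfold a eps (n + 1))); [|lra].
    apply (stays_above_before_fold (n + 1) p); try lra. rewrite plus_IZR. lra.
Qed.

Lemma v_r_eq (xa x : R) (n : Z) : xfold a eps n <= x < xfold a eps n + 4 ->
  v_r a eps xa x =
  if Rle_dec (x - xfold a eps n) xa then vminus a eps x (xfold a eps n) else -1.
Proof.
  intros Hx. unfold v_r. rewrite <- (Int_part_spec _ n). reflexivity.
  rewrite (xfold_eq 0). rewrite xfold_eq in Hx. lra.
Qed.

(** While [v <= -1] both functions solve the same linear equation, so their difference decays. *)
Lemma trajectory_minus_vminus (n : Z) (p x : R) : x0 < p -> p <= x ->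
  (forall y, p <= y <= x -> v y <= -1) ->
  Rabs (v x - vminus a eps x (xfold a eps n)) <= Rabs (v p - vminus a eps p (xfold a eps n)).
Proof.
  intros Hp Hpx Hv. destruct Hsmall as [Ha [He _]].
  rewrite (exponential_decay (fun y => v y - vminus a eps y (xfold a eps n)) a p x Hpx).
  - assert (0 < exp (- a * (x - p))) by apply exp_pos.
    assert (Hle : exp (- a * (x - p)) <= exp 0).
    { destruct (Req_dec (- a * (x - p)) 0) as [->|]; [lra|]. apply Rlt_le, exp_increasing. nra. }
    rewrite exp_0 in Hle. rewrite Rabs_mult, (Rabs_pos_eq (exp _)) by lra.
    assert (Hpos := Rabs_pos (v p - vminus a eps p (xfold a eps n))). nra.
  - intros y Hy. evar_last.
    + apply (is_derive_minus v (fun y => vminus a eps y (xfold a eps n))).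
      apply linear_below. lra. apply Hv. exact Hy. apply vminus_derive; lra.
    + unfold minus, plus, opp; simpl. ring.
Qed.

(** The error [d + d / eps] arises in the window after the fold and does not grow while [v] is below
    -1. The further [d] bounds [v + 1] after the return, which need not happen at the same time for
    [v] and [vminus]. *)
Lemma captured_tracks (xa d : R) :
  first_return a eps xa -> 2 - 2 * phi <= xa <= 4 ->
  (forall y, 0 <= y <= xa -> vminus a eps (xfold a eps 0 + y) (xfold a eps 0) <= -1) ->
  0 < d <= / 8 ->
  exists X, x0 < X /\ 0 < X /\ forall n, X <= xfold a eps n -> captured n ->
    captured (n + 1) /\
    forall x, xfold a eps n <= x < xfold a eps n + 4 ->
      Rabs (v x - v_r a eps xa x) <= 2 * d + d / eps.
Proof.
  intros [_ [Hret _]] Hxa HV Hd. destruct (fold_phase_spec a eps Hsmall) as [Hphi _].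
  assert (Hs := Hsmall). destruct Hs as [Ha [He _]].
  assert (Hde : 0 < d / eps) by (apply Rdiv_lt_0_compat; lra).
  destruct (leaves_at_fold d Hd) as [X [HX0 [HX Hleave]]].
  destruct (eventually_near_bottom d ltac:(lra)) as [X' [HX' Hnear]].
  exists (Rmax X X'). assert (HX1 := Rmax_l X X'). assert (HX2 := Rmax_r X X').
  split; [lra|]. split; [lra|].
  intros n Hn Hc. destruct (Hleave n ltac:(lra) Hc) as [Hd1 Hd2].
  assert (HF4 := xfold_succ a eps n).
  assert (HFx : forall y, vminus a eps (xfold a eps n + y) (xfold a eps n)
     = vminus a eps (xfold a eps 0 + y) (xfold a eps 0)).
  { intros y. rewrite <- (vminus_shift _ _ (xfold a eps 0 + y) (xfold a eps 0) n) by exact Ha.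
    rewrite !xfold_eq. f_equal; ring. }
  set (F := xfold a eps n) in *. set (V := fun x => vminus a eps x F).
  assert (HF : F = 4 * IZR n + phi) by reflexivity.
  set (B := 4 * IZR n + 2 - phi).
  assert (HVle : forall x, F <= x <= F + xa -> V x <= -1).
  { intros x Hx. unfold V. replace x with (F + (x - F)) by ring. rewrite HFx.
    apply HV. lra. }
  assert (HVret : V (F + xa) = -1). { unfold V. rewrite HFx. exact Hret. }
  assert (HVd : forall x, is_derive V x (- a * V x - sin (PI * (x / 2)) / eps)).
  { intros x. apply vminus_derive; lra. }
  assert (Hstart : forall x, F <= x <= F + d -> Rabs (v x - V x) <= d + d / eps).
  { intros x Hx.
    assert (H1 := Hd2 x Hx). assert (H2 := HVle x ltac:(lra)).
    assert (H3 : -1 - (x - F) / eps <= v x).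
    { apply slow_fall; try lra. apply Hc. intros y Hy. specialize (Hd2 y ltac:(lra)). lra. }
    assert (H4 : -1 - (x - F) / eps <= V x).
    { apply vminus_slow_fall. lra. intros y Hy. apply HVle. lra. }
    assert ((x - F) / eps <= d / eps).
    { unfold Rdiv. apply Rmult_le_compat_r; [|lra]. apply Rlt_le, Rinv_0_lt_compat. lra. }
    apply Rabs_le. lra. }
  assert (Hfree : forall x, F + d <= x <= B -> v x < -1).
  { intros x Hx. apply (falls_after_fold n (F + d) x); try (fold F); try (unfold B in Hx); lra. }
  assert (Htrack : forall x, F + d <= x -> (forall y, F + d <= y <= x -> v y <= -1) ->
            Rabs (v x - V x) <= d + d / eps).
  { intros x Hx Hv. apply Rle_trans with (Rabs (v (F + d) - V (F + d))).
    - apply trajectory_minus_vminus; try lra. exact Hv.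
    - apply Hstart. lra. }
  assert (HvB : v B < -1) by (apply Hfree; unfold B; lra).
  assert (Hphase : forall x, B <= x <= F + 4 -> phase x < 2 * IZR (n + 1) + / 2).
  { intros x Hx. apply captured_by_next_fold; try (fold F); try lra. fold B. lra.
    fold B. lra. }
  (* The next band keeps the phase within 2 of [x / 2]. *)
  assert (Hlow : forall x, B <= x <= F + 4 -> v x < -1 + d).
  { intros x Hx. apply Hnear with x; [unfold B in Hx; lra|]. fold (phase x).
    specialize (Hphase x Hx). rewrite plus_IZR in Hphase. unfold B in Hx. lra. }
  split.
  { split; [apply returns_by_next_fold|rewrite HF4; apply Hphase; unfold B];
      try (fold F); try lra. apply Hc. }
  intros x Hx. rewrite (v_r_eq xa x n Hx). fold F. change (vminus a eps x F) with (V x).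
  assert (Hwin : forall p q, B <= p -> p <= q -> q <= F + 4 -> -1 <= v p -> -1 <= v q).
  { intros p q Hp Hpq Hq. apply (stays_above_before_fold (n + 1) p q);
      rewrite ?HF4, ?plus_IZR; try (unfold B in Hp); lra. }
  destruct (Rle_dec x (F + d)) as [Hxd|Hxd].
  { destruct (Rle_dec (x - F) xa); [|lra]. specialize (Hstart x ltac:(lra)). lra. }
  destruct (Rle_dec x B) as [HxB|HxB].
  { unfold B in HxB. destruct (Rle_dec (x - F) xa); [|lra].
    assert (Rabs (v x - V x) <= d + d / eps); [|lra].
    apply Htrack. lra. intros y Hy. apply Rlt_le, Hfree. unfold B. lra. }
  specialize (Hlow x ltac:(lra)).
  assert (HBr : B <= F + xa) by (unfold B; lra).
  assert (HBd : F + d < B) by (unfold B; lra).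
  destruct (Rlt_dec (v x) (-1)) as [Hvx|Hvx].
  - assert (Hbelow : forall y, F + d <= y <= x -> v y <= -1).
    { intros y Hy. destruct (Rle_dec y B) as [HyB|HyB]. { apply Rlt_le, Hfree. lra. }
      apply Rnot_lt_le. intros Hlt. specialize (Hwin y x ltac:(lra) ltac:(lra) ltac:(lra)). lra. }
    destruct (Rle_dec (x - F) xa) as [Hxr|Hxr].
    + assert (Rabs (v x - V x) <= d + d / eps); [|lra]. apply Htrack. lra. exact Hbelow.
    (* [V] has returned first: at that time [v] is within the error of -1, and it rises from there
       to [v x < -1]. *)
    + assert (H : Rabs (v (F + xa) - V (F + xa)) <= d + d / eps).
      { apply Htrack. lra. intros y Hy. apply Hbelow. lra. }
      rewrite HVret in H. apply Rabs_le_between in H.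
      assert (v (F + xa) <= v x).
      { apply (linear_rises_before_fold a eps v (n + 1)); try lra; try exact Hsmall.
        - rewrite plus_IZR. unfold B in HBr. lra.
        - intros y Hy. apply linear_below. lra. apply Hbelow. lra.
        - intros y Hy. apply Hbelow. lra. }
      apply Rabs_le. lra.
  - destruct (Rle_dec (x - F) xa) as [Hxr|Hxr]; [|apply Rabs_le; lra].
    (* [v] has returned first, at [p]; the same argument applies with the roles exchanged. *)
    destruct (first_hit v B x (-1)) as [p [Hp [Ep Hbelow]]]; try lra.
    { intros y Hy. apply trajectory_continuous. lra. }
    assert (H : Rabs (v p - V p) <= d + d / eps).
    { apply Htrack. lra. intros y Hy. destruct (Rle_dec y B) as [HyB|HyB].
      apply Rlt_le, Hfree. lra. apply Hbelow. lra. }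
    rewrite Ep in H. apply Rabs_le_between in H.
    assert (V p <= V x).
    { apply (linear_rises_before_fold a eps V (n + 1)); try lra; try exact Hsmall.
      - rewrite plus_IZR. unfold B in Hp. lra.
      - intros y Hy. apply HVd.
      - intros y Hy. apply HVle. lra. }
    specialize (HVle x ltac:(lra)). apply Rabs_le. lra.
Qed.

(** * Capture of every trajectory *)

(* If no band ever catches the trajectory, then v >= 1 - c eventually, for every c > 0.
   With T m the time at which 3 x / 2 = 2m + 1, this forces v(T (m + 1)) <= v(T m) - a / 4
   for all large m. *)
Lemma falls_through_top (X : R) : exists (y : R) (m : Z),
  X <= y /\ x0 < y /\ 0 < y /\ v y <= 1 /\ phase y <= 2 * IZR m + / 4 /\
  2 * IZR m + / 4 <= 3 * y / 2 /\ y <= 4 * IZR m.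
Proof.
  apply NNPP. intros HN.
  assert (Hs := Hsmall). destruct Hs as [Ha [He _]]. assert (HP := PI_RGT_0).
  assert (Hie : 0 < / eps) by (apply Rinv_0_lt_compat; lra).
  (* [h] is the length of the layer before [T m] in which [v] may be below 1; the first bound limits
     its cost to [a / 4] per cycle. *)
  set (h := Rmin (a / (4 * (a + / eps))) (/ a)).
  assert (Hh0 : 0 < h).
  { apply Rmin_glb_lt. apply Rdiv_lt_0_compat; lra. apply Rinv_0_lt_compat; lra. }
  assert (Hh1 : (a + / eps) * h <= a / 4).
  { apply Rle_trans with ((a + / eps) * (a / (4 * (a + / eps)))).
    - apply Rmult_le_compat_l. lra. apply Rmin_l.
    - right. field. split; nra. }
  assert (Hh2 : a * h <= 1).
  { apply Rle_trans with (a * / a). apply Rmult_le_compat_l. lra. apply Rmin_r.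
    right. field. lra. }
  assert (Hh3 : h <= / 4) by nra.
  destruct (eventually_near_top (a * h / 2) ltac:(nra)) as [X1 [HX1 Htop]].
  set (X2 := Rmax (Rmax X X1) (Rmax (x0 + 1) 3)).
  assert (HX2 : X <= X2 /\ X1 <= X2 /\ x0 + 1 <= X2 /\ 3 <= X2).
  { unfold X2. assert (H1 := Rmax_l (Rmax X X1) (Rmax (x0 + 1) 3)).
    assert (H2 := Rmax_r (Rmax X X1) (Rmax (x0 + 1) 3)).
    assert (H3 := Rmax_l X X1). assert (H4 := Rmax_r X X1).
    assert (H5 := Rmax_l (x0 + 1) 3). assert (H6 := Rmax_r (x0 + 1) 3). lra. }
  assert (HN' : forall y m, X2 <= y -> v y <= 1 -> 2 * IZR m + / 4 <= 3 * y / 2 ->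
            y <= 4 * IZR m -> 2 * IZR m + / 4 < phase y).
  { intros y m Hy Hv H1 H2. apply Rnot_le_lt. intros H3. apply HN. exists y, m.
    repeat split; lra. }
  assert (Hnear : forall x, X2 <= x -> 1 - a * h / 2 < v x).
  { intros x Hx. apply Rnot_le_lt. intros Hv.
    assert (Hph : phase x < 3 * x / 2 - 2).
    { apply Rnot_le_lt. intros H. specialize (Htop x (v x) ltac:(lra) H). lra. }
    (* The highest lower edge [2 m + 1/4] not above [3 x / 2] is within 2 of it; [x >= 3] ensures
       [x <= 4 m]. *)
    destruct (base_Int_part ((3 * x / 2 - / 4) / 2)) as [Hi1 Hi2].
    set (m := Int_part ((3 * x / 2 - / 4) / 2)) in *.
    specialize (HN' x m Hx ltac:(nra) ltac:(lra) ltac:(lra)). lra. }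
  (* [Y m] and [T m] are the times at which [3 x / 2] equals [2 m + 1/4] and [2 m + 1]. *)
  set (Y := fun m : Z => (4 * IZR m + / 2) / 3).
  set (T := fun m : Z => (4 * IZR m + 2) / 3).
  assert (HS : forall m, Y (m + 1)%Z = Y m + 4 / 3 /\ T (m + 1)%Z = T m + 4 / 3 /\ T m = Y m + / 2
             /\ IZR m = (3 * Y m - / 2) / 4).
  { intros m. unfold Y, T. rewrite plus_IZR. lra. }
  assert (Hrange : forall m x, X2 <= Y m -> Y m <= x <= T m ->
            2 * IZR m + / 4 <= phase x <= 2 * IZR m + 1).
  { intros m x Hm Hx. destruct (HS m) as [_ [_ [E1 E2]]].
    assert (Hb := phase_bounds x ltac:(lra)). split; [|lra].
    destruct (Rle_dec (v x) 1) as [Hv|Hv].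
    - apply Rlt_le, HN'; lra.
    - rewrite phase_above; lra. }
  assert (Hfall : forall m p q, X2 <= Y m -> Y m <= p -> p <= q -> q <= T m ->
            v q - v p <= - a / 2 * (q - p)).
  { intros m p q Hm Hp Hpq Hq.
    apply (increment_le v (fun y => - a * v y - sin (PI * phase y) / eps)); [exact Hpq| |].
    - intros y Hy. apply trajectory_derive. lra.
    - intros y Hy. assert (Hv := Hnear y ltac:(lra)).
      assert (Hph := Hrange m y Hm ltac:(lra)).
      assert (Hsin : sin (PI * 0) <= sin (PI * phase y)) by (apply (sin_phase_ge _ _ m); lra).
      rewrite Rmult_0_r, sin_0 in Hsin.
      assert (0 <= sin (PI * phase y) / eps) by (apply Rmult_le_pos; lra).
      nra. }
  (* A value below 1 with time [h] left would lose another [a * h / 2] by [T m], against [Hnear]. *)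
  assert (Habove : forall m x, X2 <= Y m -> Y m <= x <= T m - h -> 1 <= v x).
  { intros m x Hm Hx. apply Rnot_lt_le. intros Hlt.
    assert (H := Hfall m x (T m) Hm ltac:(lra) ltac:(lra) ltac:(lra)).
    destruct (HS m) as [_ [_ [E1 _]]].
    assert (H' := Hnear (T m) ltac:(lra)). nra. }
  (* Integrated up to [q], where the cosine is almost -1, the forcing adds at most [h / eps], while
     the damping removes at least [a * (1/2 - h)]. *)
  assert (Hcycle : forall m t, X2 <= Y m -> T m <= t <= Y (m + 1)%Z ->
            (forall x, t <= x <= Y (m + 1)%Z -> 1 <= v x) ->
            v (T (m + 1)%Z) <= v t - a / 4).
  { intros m t Hm Ht Hv. destruct (HS m) as [EY [ET [E1 _]]].
    set (q := T (m + 1)%Z - h).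
    assert (Hq : v (T (m + 1)%Z) - v q <= - a / 2 * (T (m + 1)%Z - q)).
    { apply (Hfall (m + 1)%Z); unfold q; lra. }
    assert (H := forced_above v a (/ eps) (3 * PI / 2) t q).
    assert (H' : v q - v t <= - a * (q - t) + / eps / (3 * PI / 2) *
                   (cos (3 * PI / 2 * q) - cos (3 * PI / 2 * t))).
    { assert (Hv' : forall x, t <= x <= q -> 1 <= v x).
      { intros x Hx. destruct (Rle_dec x (Y (m + 1)%Z)). apply Hv; lra.
        apply (Habove (m + 1)%Z); unfold q in Hx; lra. }
      apply H; try lra.
      - unfold q. lra.
      - intros x Hx. evar_last. apply trajectory_derive. lra.
        rewrite phase_above by (apply Hv'; exact Hx).
        replace (3 * PI / 2 * x) with (PI * (3 * x / 2)) by field. unfold Rdiv. ring.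
      - exact Hv'. }
    assert (Hcos : cos (3 * PI / 2 * q) - cos (3 * PI / 2 * t) <= 3 * PI / 2 * h).
    { destruct (COS_bound (3 * PI / 2 * t)) as [Hc _].
      replace (3 * PI / 2 * q) with (- (3 * PI / 2 * h) + PI + 2 * IZR (m + 1) * PI).
      2: { unfold q, T. rewrite !plus_IZR. field. }
      rewrite cos_period_Z, neg_cos, cos_neg.
      assert (Hc1 := cos_ge_1_minus (3 * PI / 2 * h) ltac:(nra)). lra. }
    assert (Hk : 0 < / eps / (3 * PI / 2)) by (apply Rdiv_lt_0_compat; lra).
    assert (Hkh : / eps / (3 * PI / 2) * (cos (3 * PI / 2 * q) - cos (3 * PI / 2 * t)) <= / eps * h).
    { apply Rle_trans with (/ eps / (3 * PI / 2) * (3 * PI / 2 * h)).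
      - apply Rmult_le_compat_l; lra.
      - right. field. split; lra. }
    assert (- a * (q - t) <= - a * (/ 2 - h)) by (unfold q; nra).
    assert (- a / 2 * (T (m + 1)%Z - q) <= 0) by (unfold q; nra).
    lra. }
  assert (Hdown : forall (k : nat) m, X2 <= Y m -> v (T m) <= 1 + INR k * (a / 4) -> False).
  (* After a last passage up through 1, one cycle would end at or below [1 - a / 4], against
     [Hnear]. Hence [v > 1] between the layers, and every cycle costs [a / 4]. *)
  { assert (Hlast : forall m x, X2 <= Y m -> T m <= x <= Y (m + 1)%Z -> v x <= 1 -> False).
    { intros m x Hm Hx Hv. destruct (HS m) as [EY [ET [E1 _]]].
      destruct (last_hit v x (Y (m + 1)%Z) 1) as [t [Ht [Et Hgt]]]; try lra.
      { intros y Hy. apply trajectory_continuous. lra. }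
      { apply (Habove (m + 1)%Z); lra. }
      assert (H := Hcycle m t Hm ltac:(lra) Hgt).
      assert (H' := Hnear (T (m + 1)%Z) ltac:(lra)). nra. }
    induction k as [|k IH]; intros m Hm Hv; destruct (HS m) as [EY [ET [E1 _]]].
    - simpl in Hv. apply (Hlast m (T m)); lra.
    - rewrite S_INR in Hv. apply (IH (m + 1)%Z); [lra|].
      assert (H := Hcycle m (T m) Hm ltac:(lra)).
      cut (v (T (m + 1)%Z) <= v (T m) - a / 4); [lra|]. apply H.
      intros x Hx. apply Rnot_lt_le. intros Hlt. apply (Hlast m x); lra. }
  destruct (archimed X2) as [Hup _].
  set (m := up X2) in *.
  assert (Hm : X2 <= Y m) by (unfold Y; lra).
  destruct (INR_unbounded ((v (T m) - 1) / (a / 4))) as [k Hk].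
  apply (Hdown k m Hm).
  apply Rmult_lt_compat_r with (r := a / 4) in Hk; [|lra].
  replace ((v (T m) - 1) / (a / 4) * (a / 4)) with (v (T m) - 1) in Hk by (field; lra). lra.
Qed.

(** Unless [v] is back at -1 by the next fold, it obeys the linear equation for the whole period and
    gains at least [4 a]; [k] bounds the number of such periods. *)
Lemma captured_after_free_cycles (k : nat) : forall m : Z,
  x0 < xfold a eps m -> 0 < xfold a eps m ->
  phase (xfold a eps m) < 2 * IZR m + / 2 ->
  -1 - INR k * (4 * a) <= v (xfold a eps m) ->
  exists n : Z, xfold a eps m <= xfold a eps n /\ captured n.
Proof.
  destruct (fold_phase_spec a eps Hsmall) as [Hphi _].
  induction k as [|k IH]; intros m H0 Hpos Hph Hv;
    destruct (Rle_dec (-1) (v (xfold a eps m))) as [Hge|Hlt];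
    try (exists m; split; [lra|split; assumption]).
  - simpl in Hv. lra.
  - rewrite S_INR in Hv. assert (HF4 := xfold_succ a eps m).
    assert (HF : xfold a eps m = 4 * IZR m + phi) by reflexivity.
    assert (Hfree : forall x, xfold a eps m <= x <= 4 * IZR m + 2 - phi -> v x < -1).
    { intros x Hx. apply (falls_after_fold m (xfold a eps m) x); lra. }
    destruct (IH (m + 1)%Z) as [n [Hn Hc]]; try lra.
    + apply captured_by_next_fold; try lra. apply Rlt_le, Hfree. lra.
    + assert (Hk := pos_INR k). assert (Hs := Hsmall). destruct Hs as [Ha _].
      destruct (Rle_dec (-1) (v (xfold a eps (m + 1)))) as [Hge'|Hlt']; [nra|].
      assert (Hbelow : forall x, xfold a eps m <= x <= xfold a eps (m + 1) -> v x <= -1).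
      { intros x Hx. destruct (Rle_dec x (4 * IZR m + 2 - phi)). { apply Rlt_le, Hfree. lra. }
        apply Rnot_lt_le. intros Hgt. apply Hlt'.
        apply (stays_above_before_fold (m + 1) x); rewrite ?plus_IZR; lra. }
      assert (H := linear_returns a eps v m (xfold a eps m) Hsmall ltac:(lra) ltac:(lra)).
      rewrite HF4 in *.
      assert (v (xfold a eps m) + a * (xfold a eps m + 4 - xfold a eps m)
                <= v (xfold a eps m + 4)); [|lra].
      apply H; [|exact Hbelow].
      intros x Hx. apply linear_below. lra. apply Hbelow. exact Hx.
    + exists n. split; [lra|exact Hc].
Qed.

(** The band that catches the trajectory secures the phase condition at fold [m]. There [v] may
    still be far below -1, which finitely many periods repair. *)
Lemma eventually_captured (X : R) : exists n : Z, X <= xfold a eps n /\ captured n.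
Proof.
  destruct (fold_phase_spec a eps Hsmall) as [Hphi _].
  destruct (falls_through_top X) as [y [m [HX [H0 [Hpos [Hv [Hph [Hm1 Hm2]]]]]]]].
  assert (HF := xfold_eq m). assert (Ha := Hsmall). destruct Ha as [Ha _].
  destruct (INR_unbounded ((-1 - v (xfold a eps m)) / (4 * a))) as [k Hk].
  apply Rmult_lt_compat_r with (r := 4 * a) in Hk; [|lra].
  replace ((-1 - v (xfold a eps m)) / (4 * a) * (4 * a)) with (-1 - v (xfold a eps m)) in Hk
    by (field; lra).
  destruct (captured_after_free_cycles k m) as [n [Hn Hc]]; try lra.
  - apply (phase_barrier m y); lra.
  - exists n. split; [lra|exact Hc].
Qed.

Lemma trajectory_tends_to_v_r (xa : R) :
  first_return a eps xa -> 2 - 2 * phi <= xa <= 4 ->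
  (forall y, 0 <= y <= xa -> vminus a eps (xfold a eps 0 + y) (xfold a eps 0) <= -1) ->
  is_lim (fun x => v x - v_r a eps xa x) p_infty 0.
Proof.
  intros Hret Hxa HV. apply is_lim_spec. intros e. assert (He := cond_pos e).
  assert (Hs := Hsmall). destruct Hs as [Ha [Heps _]].
  assert (Hie : 0 < / eps) by (apply Rinv_0_lt_compat; lra).
  (* Chosen so that the tracking error [(2 + 1 / eps) * d] is at most [e / 2]. *)
  set (d := Rmin (/ 8) (e / (2 * (2 + / eps)))).
  assert (Hd : 0 < d <= / 8).
  { split; [|apply Rmin_l]. apply Rmin_glb_lt. lra. apply Rdiv_lt_0_compat; lra. }
  assert (Hde : 2 * d + d / eps < e).
  { apply Rle_lt_trans with ((2 + / eps) * (e / (2 * (2 + / eps)))).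
    - replace (2 * d + d / eps) with ((2 + / eps) * d) by (unfold Rdiv; ring).
      apply Rmult_le_compat_l. lra. apply Rmin_r.
    - replace ((2 + / eps) * (e / (2 * (2 + / eps)))) with (e / 2). lra.
      field. split; nra. }
  destruct (captured_tracks xa d Hret Hxa HV Hd) as [X [_ [_ Hstep]]].
  destruct (eventually_captured X) as [n0 [Hn0 Hc0]].
  assert (Hc : forall k : nat, captured (n0 + Z.of_nat k) /\ X <= xfold a eps (n0 + Z.of_nat k)).
  { induction k as [|k [IH1 IH2]].
    - rewrite Z.add_0_r. auto.
    - replace (n0 + Z.of_nat (S k))%Z with (n0 + Z.of_nat k + 1)%Z by lia.
      split. apply Hstep; assumption. rewrite xfold_succ. lra. }
  exists (xfold a eps n0). intros x Hx.
  destruct (base_Int_part ((x - xfold a eps n0) / 4)) as [Hi1 Hi2].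
  set (j := Int_part ((x - xfold a eps n0) / 4)) in *.
  assert (Hj : (0 <= j)%Z). { assert (-1 < j)%Z; [|lia]. apply lt_IZR. lra. }
  specialize (Hc (Z.to_nat j)). rewrite Z2Nat.id in Hc by exact Hj.
  destruct Hc as [Hc HX]. destruct (Hstep _ HX Hc) as [_ Hb].
  rewrite Rminus_0_r. apply Rle_lt_trans with (2 := Hde). apply Hb.
  rewrite !xfold_eq, ?plus_IZR in *. lra.
Qed.

End StepShaped.

Theorem theorem8 :
  forall (psi : R -> R), transition_function psi ->
  forall a : R, 0 < a ->
  exists eps0 : R, 0 < eps0 /\
    forall eps : R, 0 < eps < eps0 ->
      exists xa : R, first_return a eps xa /\
        forall (x0 : R) (v : R -> R), trajectory psi a eps x0 v ->
          is_lim (fun x => v x - v_r a eps xa x) p_infty 0.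
Proof.
  intros psi Hpsi a Ha. assert (HP := PI_RGT_0).
  set (s := Rmin (/ 4) (sin (PI / 16))).
  assert (Hs0 : 0 < s). { apply Rmin_glb_lt. lra. apply sin_gt_0; lra. }
  assert (Hs1 : s <= / 4) by apply Rmin_l.
  assert (Hs2 : s <= sin (PI / 16)) by apply Rmin_r.
  (* [eps < s / a] yields both bounds on [a * eps] in [small_parameter]. *)
  exists (Rmin (/ 48) (s / a)). split.
  { apply Rmin_glb_lt. lra. apply Rdiv_lt_0_compat; lra. }
  intros eps He.
  assert (He1 := Rmin_l (/ 48) (s / a)). assert (He2 := Rmin_r (/ 48) (s / a)).
  assert (Hae : a * eps <= s).
  { replace s with (a * (s / a)) by (field; lra). apply Rmult_le_compat_l; lra. }
  assert (Hsmall : small_parameter a eps) by (repeat split; lra).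
  destruct (first_return_exists a eps Hsmall) as [xa [Hret [Hxa HV]]].
  exists xa. split; [exact Hret|].
  intros x0 v Htraj.
  apply trajectory_tends_to_v_r with psi x0; try assumption.
  apply transition_function_step_shaped. exact Hpsi.
Qed.
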